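(* Let $(X,\preceq,G)$ be a complete partially ordered $G$-metric space and let $T:X\to X$ be a non-decreasing map such that $x_0\preceq Tx_0$ for some $x_0\in X$. Suppose that there exist $\psi\in\Psi$ and $\phi\in\Phi$ such that for all $x,y\in X$ with $x\preceq y$, $$\psi(G(Tx,Ty,T^2x))\le\psi(N(x,y,Tx))-\phi(N(x,y,Tx)),$$ where $$N(x,y,Tx)=\max\Big\{G(x,Tx,y),\;G(Tx,T^2x,T^2x),\;\tfrac12\big[G(x,Tx,Tx)+G(y,Ty,Ty)\big],\;\tfrac12\big[G(x,T^2x,Ty)+G(Tx,Tx,y)\big]\Big\}.$$ If either $T$ is $G$-continuous or $(X,\preceq,G)$ is regular non-decreasing, then $T$ has a fixed point in $X$.
   Context: A $G$-metric on a nonempty set $X$ is a function $G:X\times X\times X\to[0,\infty)$ such that: (G1) $G(x,y,z)=0$ if $x=y=z$; (G2) $0<G(x,x,y)$ for all $x,y\in X$ with $x\ne y$; (G3) $G(x,x,y)\le G(x,y,z)$ for all $x,y,z\in X$ with $y\neq z$; (G4) $G$ is invariant under all permutations of its three arguments; (G5) $G(x,y,z)\le G(x,a,a)+G(a,y,z)$ for all $x,y,z,a\in X$. A partially ordered $G$-metric space $(X,\preceq,G)$ is a nonempty set $X$ with a partial order $\preceq$ and a $G$-metric $G$. A sequence $(x_n)$ $G$-converges to $x$ if $G(x,x_n,x_m)\to0$ as $n,m\to\infty$; it is $G$-Cauchy if $G(x_n,x_m,x_l)\to 0$ as $n,m,l\to\infty$; the space is complete if every $G$-Cauchy sequence $G$-converges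 to some point of $X$. $T$ is $G$-continuous if $x_n\to x$ implies $Tx_n\to Tx$ (in the sense of $G$-convergence). $T$ is non-decreasing if $x\preceq y$ implies $Tx\preceq Ty$. $(X,\preceq,G)$ is regular non-decreasing if for every $\preceq$-non-decreasing sequence $(x_n)$ in $X$ with $x_n\to x^*$ one has $x_n\preceq x^*$ for all $n\in\mathbb N$. $\Psi$ is the set of functions $\psi:[0,\infty)\to[0,\infty)$ that are continuous, non-decreasing and satisfy $\psi(t)=0$ iff $t=0$. $\Phi$ is the set of functions $\phi:[0,\infty)\to[0,\infty)$ that are lower semi-continuous and satisfy $\phi(t)=0$ iff $t=0$. $T^2x$ means $T(Tx)$. *)

(* Defs.v *)
From HB Require Import structures.
From mathcomp Require Import all_boot all_order all_algebra.
From mathcomp Require Import all_classical all_reals all_analysis.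

Set Implicit Arguments.
Unset Strict Implicit.
Unset Printing Implicit Defensive.

Import Order.TTheory GRing.Theory Num.Theory.
Import numFieldNormedType.Exports.

Local Open Scope classical_set_scope.
Local Open Scope ring_scope.

Record is_Gmetric (R : realType) (X : Type) (G : X -> X -> X -> R) : Prop :=
  IsGmetric {
    Gmetric_ge0 : forall x y z, 0 <= G x y z ;
    Gmetric_xxx : forall x y z, x = y -> y = z -> G x y z = 0 ;
    Gmetric_gt0 : forall x y, x <> y -> 0 < G x x y ;
    Gmetric_le : forall x y z, y <> z -> G x x y <= G x y z ;
    Gmetric_sym : forall x y z,
      [/\ G x y z = G x z y, G x y z = G y x z, G x y z = G y z x,
          G x y z = G z x y & G x y z = G z y x] ;
    Gmetric_triangle : forall x y z a, G x y z <= G x a a + G a y z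
  }.

Section GmetricNotions.
Variables (R : realType) (X : Type) (G : X -> X -> X -> R).

(* The indices tend to infinity independently, i.e. along the product filter. *)
Definition Gcvg (u : nat -> X) (x : X) : Prop :=
  G x (u k.1) (u k.2) @[k --> (\oo, \oo)] --> (0 : R).

Definition Gcauchy (u : nat -> X) : Prop :=
  G (u k.1.1) (u k.1.2) (u k.2) @[k --> ((\oo, \oo), \oo)] --> (0 : R).

Definition Gcomplete : Prop :=
  forall u : nat -> X, Gcauchy u -> exists x, Gcvg u x.

Definition Gcontinuous (T : X -> X) : Prop :=
  forall (u : nat -> X) (x : X), Gcvg u x -> Gcvg (T \o u) (T x).

Definition Nmax (T : X -> X) (x y : X) : R :=
  Num.max (G x (T x) y)
 (Num.max (G (T x) (T (T x)) (T (T x)))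
 (Num.max (2^-1 * (G x (T x) (T x) + G y (T y) (T y)))
          (2^-1 * (G x (T (T x)) (T y) + G (T x) (T x) y)))).

End GmetricNotions.

Definition regular_nondecreasing (R : realType) (d : Order.disp_t)
    (X : porderType d) (G : X -> X -> X -> R) : Prop :=
  forall (u : nat -> X) (x : X),
    nondecreasing_seq u -> Gcvg G u x -> forall n, (u n <= x)%O.

(* A function [0, +oo[ -> [0, +oo[ is represented by a total function on R
   whose values outside [0, +oo[ are never constrained. *)
Record in_Psi (R : realType) (psi : R -> R) : Prop := InPsi {
  Psi_ge0 : forall t : R, 0 <= t -> 0 <= psi t ;
  Psi_continuous : {within `[0, +oo[, continuous psi} ;
  Psi_nondecreasing : forall s t : R, 0 <= s -> s <= t -> psi s <= psi t ;
  Psi_eq0 : forall t : R, 0 <= t -> (psi t = 0 <-> t = 0)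
}.

(* Points outside [0, +oo[ are isolated in the subspace topology, so
   semi-continuity is only required relatively to [0, +oo[. *)
Record in_Phi (R : realType) (phi : R -> R) : Prop := InPhi {
  Phi_ge0 : forall t : R, 0 <= t -> 0 <= phi t ;
  Phi_lsc : lower_semicontinuous
    ((fun t => (phi t)%:E) : subspace (`[0, +oo[ : set R) -> \bar R) ;
  Phi_eq0 : forall t : R, 0 <= t -> (phi t = 0 <-> t = 0)
}.

(* Main.v *)
(* Let u n = T^n x0, a nondecreasing sequence. On consecutive terms the maximum N
   is the larger of the steps G(u n, u n+1, u n+1) and G(u n+1, u n+2, u n+2), so
   the contraction forces the steps to decrease, and passing to the limit in it
   forces them to 0. If u were not Cauchy, one could pick pairs (n k, m k) with
   m k minimal such that G(u (n k), u (n k), u (m k)) >= e; as the steps vanish,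
   both N and the left-hand side would tend to e along these pairs, and the limit
   of the contraction inequality would give e = 0. The limit z of u is a fixed
   point by continuity of T, or else by the same limit argument applied to
   (u n, z), which are comparable by regularity. *)

Require Import Defs.
From HB Require Import structures.
From mathcomp Require Import all_boot all_order all_algebra.
From mathcomp Require Import all_classical all_reals all_analysis.
From mathcomp Require Import lra.

Set Implicit Arguments.
Unset Strict Implicit.
Unset Printing Implicit Defensive.

Import Order.TTheory GRing.Theory Num.Theory.
Import numFieldNormedType.Exports.

Local Open Scope classical_set_scope.
Local Open Scope ring_scope.

(** * The symmetric metric attached to a G-metric *)

Section GmetricDistance.
Context (R : realType) (X : Type) (G : X -> X -> X -> R).
Hypothesis Gm : is_Gmetric G.

Let G_ge0 := Gmetric_ge0 Gm.
Let G_triangle := Gmetric_triangle Gm.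

Lemma GC x y z : G x y z = G y x z.
Proof. by have [] := Gmetric_sym Gm x y z. Qed.

Lemma GAC x y z : G x y z = G x z y.
Proof. by have [] := Gmetric_sym Gm x y z. Qed.

Lemma Gcycle x y z : G x y z = G y z x.
Proof. by have [] := Gmetric_sym Gm x y z. Qed.

Lemma Gxxx x : G x x x = 0.
Proof. exact: (Gmetric_xxx Gm). Qed.

Lemma Gxxy_le x y : G x x y <= 2 * G x y y.
Proof. by have := G_triangle x x y y; rewrite [G y x y]GC; lra. Qed.

(* [G] is 1-Lipschitz in each argument for this symmetric metric, so limits of
   [G (u n) (v n) (w n)] can be computed by moving each argument separately. *)
Definition gdist x y := G x x y + G x y y.

Lemma gdist_ge0 x y : 0 <= gdist x y.
Proof. by rewrite addr_ge0. Qed.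

Lemma gdistC x y : gdist x y = gdist y x.
Proof. by rewrite /gdist addrC (Gcycle x y y) (Gcycle y x x). Qed.

Lemma gdistxx x : gdist x x = 0.
Proof. by rewrite /gdist Gxxx addr0. Qed.

Lemma gdist_eq0 x y : gdist x y = 0 -> x = y.
Proof.
move=> xy0; apply: contrapT => /(Gmetric_gt0 Gm) xy.
by move: xy0 (G_ge0 x y y); rewrite /gdist; lra.
Qed.

Lemma gdist_le x y : gdist x y <= 3 * G x y y.
Proof. by rewrite /gdist; have := Gxxy_le x y; lra. Qed.

Lemma gdist_le_xxy x y : gdist x y <= 3 * G x x y.
Proof. by rewrite gdistC; have := gdist_le y x; rewrite (Gcycle y x x). Qed.

Lemma G_dist_arg1 x a y z : `|G x y z - G a y z| <= gdist x a.
Proof.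
rewrite ler_distl /gdist; have := G_triangle x y z a; have := G_triangle a y z x.
rewrite (Gcycle a x x); move: (G_ge0 x x a) (G_ge0 x a a).
by move=> ? ? ? ?; apply/andP; split; lra.
Qed.

Lemma G_dist x y z a b c :
  `|G x y z - G a b c| <= gdist x a + gdist y b + gdist z c.
Proof.
have h1 := G_dist_arg1 x a y z.
have h2 := G_dist_arg1 y b a z; rewrite (GC y a z) (GC b a z) in h2.
have h3 := G_dist_arg1 z c a b; rewrite (Gcycle z a b) (Gcycle c a b) in h3.
move: h1 h2 h3; rewrite !ler_distl => /andP[? ?] /andP[? ?] /andP[? ?].
by apply/andP; split; lra.
Qed.

Lemma gdist_triangle y x z : gdist x z <= gdist x y + gdist y z.
Proof.
rewrite /gdist; have := G_triangle x z z y; have := G_triangle z x x y.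
by rewrite (Gcycle z x x) (Gcycle z y y) (Gcycle y x x); lra.
Qed.

Lemma cvg_G (u v w u' v' w' : nat -> X) (l : R) :
  gdist (u n) (u' n) @[n --> \oo] --> (0 : R) ->
  gdist (v n) (v' n) @[n --> \oo] --> (0 : R) ->
  gdist (w n) (w' n) @[n --> \oo] --> (0 : R) ->
  G (u' n) (v' n) (w' n) @[n --> \oo] --> l ->
  G (u n) (v n) (w n) @[n --> \oo] --> l.
Proof.
move=> uu' vv' ww'; apply: cvg_sub0; apply/norm_cvg0P.
have dist0 : gdist (u n) (u' n) + gdist (v n) (v' n) + gdist (w n) (w' n)
    @[n --> \oo] --> (0 : R).
  by rewrite -[X in _ --> X](addr0 0) -[X in _ --> X + _](addr0 0);
    do 2 ?apply: cvgD.
apply: (squeeze_cvgr _ (cvg_cst 0) dist0); apply: nearW => n.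
by rewrite normr_ge0 G_dist.
Qed.

Lemma GcvgP (u : nat -> X) (x : X) :
  Gcvg G u x <-> gdist (u n) x @[n --> \oo] --> (0 : R).
Proof.
split=> [/cvgr0Pnorm_lt ux|/cvgr0Pnorm_lt ux]; apply/cvgr0Pnorm_lt => e e0.
  (* Diagonal indices suffice, because [gdist] is at most 3 times the value at [x (u n) (u n)]. *)
  have [|[A B] [/= Aoo Boo] AB] := ux (e / 3); first by rewrite divr_gt0.
  near=> n; have /AB /= : (A `*` B) (n, n) by split; near: n.
  rewrite !ger0_norm// ?gdist_ge0// => lt_e.
  by rewrite gdistC; have := gdist_le x (u n); lra.
have /ux ux' : 0 < e / 2 by rewrite divr_gt0.
exists ([set n | `|gdist (u n) x| < e / 2],
        [set n | `|gdist (u n) x| < e / 2]) => // -[i j] /= [].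
rewrite !ger0_norm ?gdist_ge0// => di dj.
have := G_dist x (u i) (u j) x x x; rewrite gdistxx Gxxx subr0 ger0_norm//.
lra.
Unshelve. all: by end_near. Qed.

Lemma Gcauchy_ordered (u : nat -> X) :
  (forall e : R, 0 < e ->
     exists K, forall n m, (K <= n)%N -> (n <= m)%N -> G (u n) (u n) (u m) < e) ->
  Gcauchy G u.
Proof.
move=> uC; apply/cvgr0Pnorm_lt => e e0.
(* A factor 3 bounds [gdist] by [G], and a factor 2 pays for the two arguments moved to reach
   [G (u j) (u j) (u j) = 0]. *)
have [|K uK] := uC (e / 6); first by rewrite divr_gt0.
have dK n m : (K <= n)%N -> (K <= m)%N -> gdist (u n) (u m) < e / 2.
  wlog nm : n m / (n <= m)%N => [wh Kn Km|Kn _].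
    by have [nm|/ltnW mn] := leqP n m; [|rewrite gdistC]; exact: wh.
  by have := gdist_le_xxy (u n) (u m); have := uK _ _ Kn nm; lra.
exists ([set k | (K <= k.1)%N && (K <= k.2)%N], [set k | (K <= k)%N]).
  split; last by exists K.
  by exists ([set k | (K <= k)%N], [set k | (K <= k)%N]) => [|[i j] /= [-> ->]//];
    split; exists K.
move=> [[i j] k] /= [/andP[Ki Kj] Kk].
have := G_dist (u i) (u j) (u k) (u j) (u j) (u j).
rewrite gdistxx Gxxx subr0 !ger0_norm// => le_d.
by have := dK _ _ Ki Kj; have := dK _ _ Kk Kj; lra.
Qed.

End GmetricDistance.

(** * Real limits in the contraction inequality *)

Lemma cvg_maxr (R : realType) (f g : nat -> R) (a b : R) :
  f @ \oo --> a -> g @ \oo --> b ->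
  Num.max (f n) (g n) @[n --> \oo] --> Num.max a b.
Proof.
move=> fa gb; under eq_fun do rewrite maxr_absE.
rewrite maxr_absE; apply: cvgMl; apply: cvgD; first exact: cvgD.
by apply: cvg_norm; exact: cvgB.
Qed.

(* Passing to the limit in the contraction inequality: continuity of [psi] and
   lower semicontinuity of [phi] give
   [psi p <= psi s - phi s <= psi p - phi s]. *)
Lemma weak_contraction_lim0 (R : realType) (psi phi : R -> R) (a b : nat -> R)
    (p s : R) :
  in_Psi psi -> in_Phi phi -> (forall n, 0 <= a n) -> (forall n, 0 <= b n) ->
  a @ \oo --> p -> b @ \oo --> s -> s <= p ->
  (forall n, psi (a n) <= psi (b n) - phi (b n)) -> s = 0.
Proof.
move=> Hpsi Hphi a0 b0 ap bs sp ab.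
have s0 : 0 <= s by apply: (cvgr_to_ge bs); exact: nearW.
have p0 : 0 <= p := le_trans s0 sp.
have in0y (t : R) : 0 <= t -> `[0, +oo[%classic t.
  by move=> t0; rewrite /= in_itv /= t0.
(* [psi] and [phi] are controlled only relatively to [[0, +oo[], so limits are taken along the trace
   of the neighbourhood filter. *)
have cvg0y (c : nat -> R) (l : R) : (forall n, 0 <= c n) ->
    c @ \oo --> l -> c @ \oo --> within `[0, +oo[ (nbhs l).
  by move=> c0 cl V /cl; apply: (@filterS nat \oo) => n; apply; exact: in0y.
have psi_cvg (c : nat -> R) (l : R) : 0 <= l -> (forall n, 0 <= c n) ->
    c @ \oo --> l -> psi (c n) @[n --> \oo] --> psi l.
  move=> l0 c0 cl.
  have /subspace_continuousP /(_ l (in0y l l0)) psil := Psi_continuous Hpsi.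
  exact: (cvg_comp _ _ (cvg0y c l c0 cl) psil).
apply/(Phi_eq0 Hphi s0)/eqP; rewrite eq_le (Phi_ge0 Hphi s0) andbT leNgt.
apply/negP => phis.
(* Semicontinuity needs a bound strictly below [phi s]; half of it is still positive, enough to
   contradict [psi s <= psi p]. *)
have [|V sV phiV] := @Phi_lsc _ _ Hphi s (phi s / 2).
  by rewrite lte_fin; lra.
have near_phi : \forall n \near \oo, phi s / 2 < phi (b n).
  have /(_ V sV) :=
    (subspace_cvgP (fmap_filter b eventually_filter) (in0y s s0)).2 (cvg0y b s b0 bs).
  by apply: (@filterS nat \oo) => n bV; rewrite -lte_fin; exact: phiV.
have : psi p <= psi s - phi s / 2.
  apply: (ler_cvg_to (psi_cvg _ _ p0 a0 ap)
    (cvgB (psi_cvg _ _ s0 b0 bs) (cvg_cst (phi s / 2)))).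
  by apply: filterS near_phi => n ?; rewrite !fctE; have := ab n; lra.
by have := Psi_nondecreasing Hpsi s0 sp; lra.
Qed.

(** * The orbit of [x0]: vanishing steps and the Cauchy property *)

Section OrbitLimits.
Context (R : realType) (d : Order.disp_t) (X : porderType d).
Context (G : X -> X -> X -> R) (T : X -> X) (psi phi : R -> R).
Hypotheses (Gm : is_Gmetric G) (Hpsi : in_Psi psi) (Hphi : in_Phi phi).
Hypothesis contraction : forall x y : X, (x <= y)%O ->
  psi (G (T x) (T y) (T (T x))) <= psi (Nmax G T x y) - phi (Nmax G T x y).

Let G_ge0 := Gmetric_ge0 Gm.

Lemma Nmax_ge0 x y : 0 <= Nmax G T x y.
Proof. by rewrite /Nmax le_max G_ge0. Qed.

Lemma contraction_lim0 (x y : nat -> X) (p s : R) :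
  (forall n, (x n <= y n)%O) ->
  G (T (x n)) (T (y n)) (T (T (x n))) @[n --> \oo] --> p ->
  Nmax G T (x n) (y n) @[n --> \oo] --> s -> s <= p -> s = 0.
Proof.
move=> xy Gp Ns sp; apply: (weak_contraction_lim0 Hpsi Hphi _ _ Gp Ns sp) => n //.
  exact: Nmax_ge0.
exact: contraction.
Qed.

(** The two halved terms do not exceed the mean of the two steps: one is that mean, and the triangle
    inequality through [T x] bounds the other. *)
Lemma Nmax_orbit x :
  Nmax G T x (T x) = Num.max (G x (T x) (T x)) (G (T x) (T (T x)) (T (T x))).
Proof.
have := Gmetric_triangle Gm x (T (T x)) (T (T x)) (T x).
set a := G x (T x) (T x); set b := G (T x) _ _ => le2.
rewrite /Nmax (Gxxx Gm) addr0 maxA -/a -/b.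
apply: max_l; rewrite ge_max !le_max; apply/andP.
by split; have [ab|/ltW ba] := leP a b; apply/orP; [right|left|right|left]; lra.
Qed.

Variable x0 : X.
Hypotheses (T_homo : {homo T : x y / (x <= y)%O}) (x0T : (x0 <= T x0)%O).

Let u n := iter n T x0.

Lemma orbit_nondecreasing : nondecreasing_seq u.
Proof.
apply/nondecreasing_seqP => n; rewrite /u.
by elim: n => // n IH; exact: T_homo.
Qed.

Let uS n : (u n <= u n.+1)%O.
Proof. by apply: orbit_nondecreasing. Qed.

Let step n := G (u n) (u n.+1) (u n.+1).

(** If a step grew to [t], the contraction would read [psi t <= psi t - phi t], forcing [t = 0]. *)
Lemma orbit_step_nonincreasing : nonincreasing_seq step.
Proof.
apply/nonincreasing_seqP => n; rewrite leNgt; apply/negP => lt_step.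
have : psi (step n.+1) <= psi (Num.max (step n) (step n.+1))
                          - phi (Num.max (step n) (step n.+1)).
  by have := contraction (uS n); rewrite Nmax_orbit.
rewrite max_r ?(ltW lt_step)// => psi_le.
have step_ge0 k : 0 <= step k by exact: G_ge0.
have phi0 := Phi_ge0 Hphi (step_ge0 n.+1).
have /(Phi_eq0 Hphi (step_ge0 _)) step0 : phi (step n.+1) = 0 by lra.
by move: lt_step; rewrite step0 ltNge step_ge0.
Qed.

Lemma orbit_step_cvg0 : step n @[n --> \oo] --> (0 : R).
Proof.
have /(nonincreasing_cvgn orbit_step_nonincreasing) : has_lbound (range step).
  by exists 0 => _ [n _ <-]; exact: G_ge0.
move: (inf _) => r stepr.
have stepSr : step n.+1 @[n --> \oo] --> r.
  by rewrite -cvg_shiftS in stepr.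
suff <- : r = 0 by [].
apply: (contraction_lim0 uS stepSr _ (lexx r)).
(* By monotonicity the earlier step is the maximum, so both sides of the contraction have the same
   limit [r]. *)
have stepE : step = (fun n => Nmax G T (u n) (u n.+1)).
  apply/funext => n; apply: esym; rewrite (Nmax_orbit (u n)); apply: max_l.
  exact: (orbit_step_nonincreasing (leqnSn n)).
by rewrite stepE in stepr.
Qed.

Lemma orbit_dist_cvg0 : gdist G (u n) (u n.+1) @[n --> \oo] --> (0 : R).
Proof.
have step3 : 3 * step n @[n --> \oo] --> (0 : R).
  by rewrite -[X in _ --> X](mulr0 3); apply: cvgMr; exact: orbit_step_cvg0.
apply: (squeeze_cvgr _ (cvg_cst 0) step3); apply: nearW => n.
by rewrite (gdist_ge0 Gm) (gdist_le Gm).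
Qed.

Lemma orbit_dist2_cvg0 : gdist G (u n) (u n.+2) @[n --> \oo] --> (0 : R).
Proof.
have dS : gdist G (u n.+1) (u n.+2) @[n --> \oo] --> (0 : R).
  by have := orbit_dist_cvg0; rewrite -cvg_shiftS.
have dD : gdist G (u n) (u n.+1) + gdist G (u n.+1) (u n.+2)
    @[n --> \oo] --> (0 : R).
  by rewrite -[X in _ --> X](addr0 0); exact: cvgD orbit_dist_cvg0 dS.
apply: (squeeze_cvgr _ (cvg_cst 0) dD); apply: nearW => n.
by rewrite (gdist_ge0 Gm) (gdist_triangle Gm).
Qed.

Let dist_sym_cvg0 (v w : nat -> X) :
  gdist G (v n) (w n) @[n --> \oo] --> (0 : R) ->
  gdist G (w n) (v n) @[n --> \oo] --> (0 : R).
Proof. by under eq_fun do rewrite (gdistC Gm). Qed.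

Let distxx_cvg0 (v : nat -> X) : gdist G (v n) (v n) @[n --> \oo] --> (0 : R).
Proof. by under eq_fun do rewrite (gdistxx Gm); exact: cvg_cst. Qed.

Let cvg_half (f : nat -> R) (l : R) :
  f @ \oo --> l -> 2^-1 * f n @[n --> \oo] --> 2^-1 * l.
Proof. by move=> fl; apply: cvgMr. Qed.

Let cvg_ge_id (n : nat -> nat) :
  (forall k, (k <= n k)%N) -> n k @[k --> \oo] --> \oo.
Proof.
move=> kn A [N _ NA]; exists N => // k /= Nk; apply: NA => /=.
exact: leq_trans Nk (kn k).
Qed.

(* If the orbit is not Cauchy, there are [n k <= m k] going to infinity along
   which [G (u (n k)) (u (n k)) (u (m k))] tends to some [e > 0]; all the terms
   of the contraction inequality then converge to [e] or [0]. *)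
Lemma orbit_Cauchy : Gcauchy G u.
Proof.
apply: Gcauchy_ordered => // e e0; apply: contrapT => not_small.
(* [nm.2] is the predecessor of the minimal index, which exceeds [nm.1] because [G] vanishes on the
   diagonal. *)
have far K : exists nm : nat * nat, [/\ (K <= nm.1)%N, (nm.1 <= nm.2)%N,
    e <= G (u nm.1) (u nm.1) (u nm.2.+1) & G (u nm.1) (u nm.1) (u nm.2) < e].
  move: not_small => /forallNP/(_ K)/existsNP[n /existsNP[m0]].
  move=> /not_implyP[Kn /not_implyP[nm0 /negP]]; rewrite -leNgt => em0.
  have exm : exists m, (n <= m)%N && (e <= G (u n) (u n) (u m)).
    by exists m0; rewrite nm0.
  case: (ex_minnP exm) => -[|m] /andP[nm em] m_min.
    by move: em; move: nm; rewrite leqn0 => /eqP ->; rewrite (Gxxx Gm) leNgt e0.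
  exists (n, m) => /=; move: nm; rewrite leq_eqVlt => /predU1P[nE|].
    by move: em; rewrite nE (Gxxx Gm) leNgt e0.
  rewrite ltnS => nm; split => //; rewrite ltNge; apply/negP => em'.
  by have := m_min m; rewrite nm em' ltnn => /(_ isT).
have {far}[nm nmP] := choice far.
pose n k := (nm k).1; pose m k := (nm k).2.+1.
have noo : n k @[k --> \oo] --> \oo by apply: cvg_ge_id => k; case: (nmP k).
have m'oo : (nm k).2 @[k --> \oo] --> \oo.
  by apply: cvg_ge_id => k; case: (nmP k) => h1 h2 _ _; exact: leq_trans h2.
have moo : m k @[k --> \oo] --> \oo.
  apply: cvg_ge_id => k; case: (nmP k) => h1 h2 _ _.
  exact: leqW (leq_trans h1 h2).
have unm k : (u (n k) <= u (m k))%O.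
  by apply: orbit_nondecreasing; case: (nmP k) => _ + _ _; exact: leqW.
have dn := cvg_comp _ _ noo orbit_dist_cvg0.
have dn2 := cvg_comp _ _ noo orbit_dist2_cvg0.
have dm := cvg_comp _ _ moo orbit_dist_cvg0.
have dm' := cvg_comp _ _ m'oo orbit_dist_cvg0.
(* The value is at least [e], and exceeds the one at the predecessor index, itself below [e], by at
   most one vanishing orbit distance. *)
have cvg_e : G (u (n k)) (u (n k)) (u (m k)) @[k --> \oo] --> e.
  have eD : e + gdist G (u (nm k).2) (u (m k)) @[k --> \oo] --> e.
    by rewrite -[X in _ --> X](addr0 e); exact: cvgD (cvg_cst e) dm'.
  apply: (squeeze_cvgr _ (cvg_cst e) eD); apply: nearW => k /=.
  have [_ _ -> /= lt_e] := nmP k.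
  have := G_dist Gm (u (n k)) (u (n k)) (u (m k))
                    (u (n k)) (u (n k)) (u (nm k).2).
  rewrite !(gdistxx Gm) (gdistC Gm (u (m k))) ler_distl => /andP[_].
  by rewrite /m; lra.
have dnS := dist_sym_cvg0 dn; have dn2S := dist_sym_cvg0 dn2.
have dmS := dist_sym_cvg0 dm.
have cvg_e1 := cvg_G Gm dnS dmS dn2S.
(* The limits of the four terms of [Nmax], in order. *)
have e_max : e = Num.max e (Num.max 0
    (Num.max (2^-1 * (0 + 0)) (2^-1 * (e + e)))).
  have -> : 2^-1 * (e + e) = e by lra.
  by rewrite addr0 mulr0 !(max_r (ltW e0)) maxxx.
have lhs : G (T (u (n k))) (T (u (m k))) (T (T (u (n k)))) @[k --> \oo] --> e.
  by apply: cvg_e1; under eq_fun do rewrite (GAC Gm).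
suff /(contraction_lim0 unm lhs)/(_ (lexx e)) :
    Nmax G T (u (n k)) (u (m k)) @[k --> \oo] --> e by lra.
rewrite [X in _ --> X]e_max.
apply: cvg_maxr.
  exact: (cvg_G Gm (distxx_cvg0 _) dnS (distxx_cvg0 _) cvg_e).
apply: cvg_maxr.
  have := orbit_step_cvg0; rewrite -cvg_shiftS => /(cvg_comp _ _ noo); exact.
apply: cvg_maxr; apply: cvg_half; apply: cvgD.
- exact: (cvg_comp _ _ noo orbit_step_cvg0).
- exact: (cvg_comp _ _ moo orbit_step_cvg0).
- apply: (cvg_G Gm (distxx_cvg0 _) dn2S dmS cvg_e).
- exact: (cvg_G Gm dnS dnS (distxx_cvg0 _) cvg_e).
Qed.

(** * The limit of the orbit is a fixed point *)

Variable z : X.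
Hypothesis uz : Gcvg G u z.

Let dz : gdist G (u n) z @[n --> \oo] --> (0 : R).
Proof. exact/(GcvgP Gm). Qed.
Let dzS : gdist G (u n.+1) z @[n --> \oo] --> (0 : R).
Proof. by have := dz; rewrite -cvg_shiftS. Qed.
Let dzSS : gdist G (u n.+2) z @[n --> \oo] --> (0 : R).
Proof. by have := dzS; rewrite -cvg_shiftS. Qed.

(** Both [z] and [T z] are limits of the shifted orbit, hence at distance 0. *)
Lemma orbit_lim_fixed_continuous : Gcontinuous G T -> T z = z.
Proof.
move=> /(_ _ _ uz)/(GcvgP Gm) dT; apply/(gdist_eq0 Gm)/eqP.
rewrite eq_le (gdist_ge0 Gm) andbT.
have dD : gdist G (T z) (u n.+1) + gdist G (u n.+1) z @[n --> \oo] --> (0 : R).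
  by rewrite -[X in _ --> X](addr0 0); exact: cvgD (dist_sym_cvg0 dT) dzS.
apply: (cvgr_to_ge dD); apply: nearW => n.
by rewrite /= (gdist_triangle Gm).
Qed.

(* The limit of [Nmax (u n) z] is half of the larger of [G z z (T z)] and
   [G z (T z) (T z)], hence at most [G z z (T z)]. *)
Lemma orbit_lim_fixed_regular : (forall n, (u n <= z)%O) -> T z = z.
Proof.
move=> u_le_z.
pose p := G z z (T z); pose q := G z (T z) (T z).
(* This keeps [q / 2], the limit of the third term of [Nmax], below the limit [p] of the left-hand
   side. *)
have q2p : q <= 2 * p.
  by have := Gxxy_le Gm (T z) z; rewrite -(Gcycle Gm z) (Gcycle Gm (T z) z).
have p0 : 0 <= p by exact: G_ge0.
have q0 : 0 <= q by exact: G_ge0.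
have lhs : G (T (u n)) (T z) (T (T (u n))) @[n --> \oo] --> p.
  apply: (cvg_G Gm dzS (distxx_cvg0 _) dzSS).
  by rewrite /p (GAC Gm); exact: cvg_cst.
pose s := Num.max 0 (Num.max 0 (Num.max (2^-1 * (0 + q)) (2^-1 * (p + 0)))).
have cvg_s : Nmax G T (u n) z @[n --> \oo] --> s.
  have cvg_zzz : G z z z @[n --> \oo] --> (0 : R).
    by rewrite (Gxxx Gm); exact: cvg_cst.
  apply: cvg_maxr; first exact: (cvg_G Gm dz dzS (distxx_cvg0 _)).
  apply: cvg_maxr.
    by have := orbit_step_cvg0; rewrite -cvg_shiftS.
  apply: cvg_maxr; apply: cvg_half; apply: cvgD.
  - exact: orbit_step_cvg0.
  - exact: cvg_cst.
  - by apply: (cvg_G Gm dz dzSS (distxx_cvg0 _)); exact: cvg_cst.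
  - exact: (cvg_G Gm dzS dzS (distxx_cvg0 _)).
have sp : s <= p by rewrite /s !ge_max p0 /=; apply/andP; split; lra.
have s0 := contraction_lim0 u_le_z lhs cvg_s sp.
have [p_le q_le] : 2^-1 * (p + 0) <= s /\ 2^-1 * (0 + q) <= s.
  by rewrite /s !le_max !lexx !orbT.
apply/esym/(gdist_eq0 Gm); rewrite /gdist -/p -/q; lra.
Qed.

End OrbitLimits.

Theorem theorem2p6 (R : realType) (d : Order.disp_t) (X : porderType d)
  (G : X -> X -> X -> R) (T : X -> X)
  (Gmetric : is_Gmetric G) (complete : Gcomplete G)
  (T_nondecreasing : {homo T : x y / (x <= y)%O})
  (x0_le_Tx0 : exists x0 : X, (x0 <= T x0)%O)
  (contraction : exists psi phi : R -> R, [/\ in_Psi psi, in_Phi phi &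
    forall x y : X, (x <= y)%O ->
      psi (G (T x) (T y) (T (T x))) <=
        psi (Nmax G T x y) - phi (Nmax G T x y)])
  (continuous_or_regular : Gcontinuous G T \/ regular_nondecreasing G) :
  exists x : X, T x = x.
Proof.
have [x0 x0T] := x0_le_Tx0; have [psi [phi [Hpsi Hphi contr]]] := contraction.
have [z uz] :=
  complete _ (orbit_Cauchy Gmetric Hpsi Hphi contr T_nondecreasing x0T).
exists z; case: continuous_or_regular => [Tcont|reg].
  exact: (orbit_lim_fixed_continuous Gmetric uz Tcont).
apply: (orbit_lim_fixed_regular Gmetric Hpsi Hphi contr T_nondecreasing x0T uz).
by apply: reg uz; exact: orbit_nondecreasing.
Qed.
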